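(* Let $(M,c,J)$ be a locally conformal Kähler manifold, $G$ a connected Lie subgroup of $\mathrm{Aut}(M)$ with Lie algebra $\mathfrak g$, and $g$ a metric in the conformal class $c$. Let $\mu^{\cdot}:\mathfrak g\to\Gamma(L^2_M)$ be a map and write $\mu^X=\mu^X_g\, l_g^2$ with $\mu_g^{\cdot}:\mathfrak g\to C^\infty(M)$. Then $\mu^{\cdot}:\mathfrak g\to\Gamma(L^2_M)$ is a momentum map in the intrinsic conformal sense (a Lie algebra homomorphism with $\iota_X\Omega=d^\nabla\mu^X$ for all $X\in\mathfrak g$) if and only if $\mu_g^{\cdot}:\mathfrak g\to C^\infty(M)$ is a momentum map with respect to $g$ (a Lie algebra homomorphism with $\iota_X\Omega_g=d^{\omega_g}\mu_g^X$ for all $X\in\mathfrak g$).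
   Context: Densities: for $M$ of real dimension $n$ and $t\in\mathbb R$, $L^t_M$ is the real line bundle whose fibre at $x$ is the space of maps $l:\Lambda^n(T_xM)\setminus0\to\mathbb R$ with $l(\lambda w)=|\lambda|^{-t/n}l(w)$ for $\lambda\neq 0$. A Riemannian metric $g$ defines the positive section $l_g^t$ of $L^t_M$ taking the value $1$ on elements of length one. A conformal structure is identified with the $L^2_M$-valued symmetric tensor $c=g\otimes l_g^2$, independent of the choice of $g$ in the conformal class. A locally conformal Kähler manifold $(M,c,J)$ is a complex manifold of complex dimension bigger than 1 with a conformal class $c$ of Hermitian metrics, each (equivalently one) of which has Kähler form $\Omega_g(X,Y)=g(JX,Y)$ with $d\Omega_g=\omega_g\wedge\Omega_g$ for a closed 1-form $\omega_g$ (Lee form). The $L^2_M$-valued fundamental form is $\Omega(X,Y)=c(JX,Y)$, i.e. $\Omega=\Omega_g\otimes l_g^2$. The connection $\nabla$ on $L^1_M$ (canonical Weyl connection) is given by $\nabla_Xl_g=-\tfrac12\omega_g(X)l_g$, independently of $g$; it induces connections on all $L^t_M$, with $\nabla l_g^2=-\omega_g\otimes l_g^2$, and an exterior covariant derivative $d^\nabla$ on $L^2_M$-valued forms. $\mathrm{Aut}(M)$ is the group of diffeomorphisms preserving $J$ and the conformal class. Elements of $\mathfrak g$ are identified with fundamental vector fields on $M$. Brackets. On $\Gamma(L^2_M)$: $\{f_1,f_2\}=\Omega(\sharp\nabla f_1,\sharp\nabla f_2)$, where $\sharp:\Omega^1(L^2_M)\to\mathfrak X(M)$ is defined by $\iota_{\sharp\alpha}\Omega=\alpha$.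 On $C^\infty(M)$, with respect to $g$: $\{f_1,f_2\}_g=\Omega_g(\sharp_gd^{\omega_g}f_1,\sharp_gd^{\omega_g}f_2)$, where $\iota_{\sharp_g\alpha}\Omega_g=\alpha$ and $d^{\omega_g}\psi=d\psi-\omega_g\wedge\psi$. Both are Lie brackets, and the homomorphism conditions refer to them. *)

(* Defs.v *)
From HB Require Import structures.
From mathcomp Require Import all_boot all_order all_algebra.
From mathcomp Require Import all_classical all_reals all_analysis.
From mathcomp Require Import ring.

Set Implicit Arguments.
Unset Strict Implicit.
Unset Printing Implicit Defensive.

Import Order.TTheory GRing.Theory Num.Theory.
Import numFieldNormedType.Exports.

Local Open Scope classical_set_scope.
Local Open Scope ring_scope.

Section Calculus.
Context {R : realType}.

Definition ebase {n} (i : 'I_n) : 'rV[R]_n := delta_mx 0 i.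

(* Functions are total; on an open set [U] the values outside [U] do not
   matter, since continuity at a point and ['D_v] only see germs.            *)
Fixpoint Ck {n} (U : set 'rV[R]_n) (k : nat) (f : 'rV[R]_n -> R) : Prop :=
  (forall u, U u -> {for u, continuous f}) /\
  if k is k'.+1 then
    forall i, (forall u, U u -> derivable f u (ebase i)) /\
              Ck U k' (fun u => 'D_(ebase i) f u)
  else True.

Definition smooth_on {n} (U : set 'rV[R]_n) (f : 'rV[R]_n -> R) : Prop :=
  forall k, Ck U k f.

Lemma Ck_cont {n} (U : set 'rV[R]_n) k f u :
  Ck U k f -> U u -> {for u, continuous f}.
Proof. by case: k => [|k] [cf _] Uu; exact: cf. Qed.

Lemma Ck_sub {n} (U V : set 'rV[R]_n) k f : U `<=` V -> Ck V k f -> Ck U k f.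
Proof.
move=> UV; elim: k f => [|k IH] f /= [cf df]; split=> //.
- by move=> u /UV; exact: cf.
- by move=> u /UV; exact: cf.
- move=> i; have [di Di] := df i; split; last exact: IH.
  by move=> u /UV; exact: di.
Qed.

Lemma Ck_weak {n} (U : set 'rV[R]_n) k f : Ck U k.+1 f -> Ck U k f.
Proof.
elim: k f => [|k IH] f [cf df]; first by split.
by split=> // i; have [di Di] := df i; split=> //; exact: IH.
Qed.

Lemma near_open_eq {T : topologicalType} {A : Type} (U : set T) (f h : T -> A) u :
  open U -> (forall u, U u -> f u = h u) -> U u -> \near u, f u = h u.
Proof.
move=> oU fh Uu; apply: filterS (open_nbhs_nbhs (conj oU Uu)) => w; exact: fh.
Qed.

Lemma near_eq_cont {T S : topologicalType} (f h : T -> S) u :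
  (\near u, f u = h u) -> {for u, continuous f} -> {for u, continuous h}.
Proof.
move=> fh cf; rewrite /prop_for /continuous_at -(nbhs_singleton fh).
apply: cvg_trans cf; apply: near_eq_cvg.
by apply: filterS fh => w ->.
Qed.

Lemma Ck_eq {n} (U : set 'rV[R]_n) k f h : open U ->
  (forall u, U u -> f u = h u) -> Ck U k f -> Ck U k h.
Proof.
move=> oU; elim: k f h => [|k IH] f h fh [cf df]; split=> //.
- by move=> u Uu; apply: near_eq_cont (cf u Uu); exact: near_open_eq oU fh Uu.
- by move=> u Uu; apply: near_eq_cont (cf u Uu); exact: near_open_eq oU fh Uu.
move=> i; have [di Di] := df i; split.
  by move=> u Uu; apply: near_eq_derivable (di u Uu); exact: near_open_eq oU fh Uu.
by apply: IH Di => u Uu; apply: near_eq_derive; exact: near_open_eq oU fh Uu.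
Qed.

Lemma Ck_cst {n} (U : set 'rV[R]_n) k (a : R) : Ck U k (fun=> a).
Proof.
elim: k a => [|k IH] a; (split; first by move=> u _; exact: cst_continuous) => // i.
split=> [u _|]; first exact: derivable_cst.
suff -> : (fun u => 'D_(ebase i) (fun=> a) u) = fun=> 0 by exact: IH.
by apply/funext => u; rewrite derive_cst.
Qed.

Lemma CkD {n} (U : set 'rV[R]_n) k f h : open U ->
  Ck U k f -> Ck U k h -> Ck U k (fun u => f u + h u).
Proof.
move=> oU; elim: k f h => [|k IH] f h [cf df] [ch dh].
  by split=> // u Uu; exact: continuousD (cf u Uu) (ch u Uu).
split; first by move=> u Uu; exact: continuousD (cf u Uu) (ch u Uu).
move=> i; have [di Di] := df i; have [ei Ei] := dh i; split.
  by move=> u Uu; apply: derivableD; [exact: di|exact: ei].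
apply: Ck_eq (IH _ _ Di Ei) => // u Uu.
by rewrite deriveD //; [exact: di|exact: ei].
Qed.

Lemma CkM {n} (U : set 'rV[R]_n) k f h : open U ->
  Ck U k f -> Ck U k h -> Ck U k (fun u => f u * h u).
Proof.
move=> oU; elim: k f h => [|k IH] f h Cf Ch.
  by split=> // u Uu; exact: continuousM (Ck_cont Cf Uu) (Ck_cont Ch Uu).
split; first by move=> u Uu; exact: continuousM (Ck_cont Cf Uu) (Ck_cont Ch Uu).
move=> i; have [_ /(_ i)[di Di]] := Cf; have [_ /(_ i)[ei Ei]] := Ch; split.
  by move=> u Uu; apply: derivableM; [exact: di|exact: ei].
have := CkD oU (IH _ _ (Ck_weak Cf) Ei) (IH _ _ (Ck_weak Ch) Di).
apply: Ck_eq => // u Uu.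
by rewrite deriveM //; [exact: di|exact: ei].
Qed.

Lemma Ck_slice {n n'} (e : 'rV[R]_n -> 'rV[R]_n') (s : 'I_n -> 'I_n') U k f :
  continuous e -> (forall u h i, e (h *: ebase i + u) = h *: ebase (s i) + e u) ->
  Ck U k f -> Ck (e @^-1` U) k (f \o e).
Proof.
move=> ce he; elim: k f => [|k IH] f [cf df]; split=> //.
- by move=> u Uu; apply: continuous_comp; [exact: ce|exact: cf].
- by move=> u Uu; apply: continuous_comp; [exact: ce|exact: cf].
have E i u : (fun h : R => h^-1 *: (((f \o e) \o shift u) (h *: ebase i) - (f \o e) u))
    = (fun h : R => h^-1 *: ((f \o shift (e u)) (h *: ebase (s i)) - f (e u))).
  by apply/funext => h /=; rewrite he.
move=> i; have [di Di] := df (s i); split.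
  by move=> u Uu; rewrite /derivable E; exact: di.
suff -> : (fun u => 'D_(ebase i) (f \o e) u) =
  (fun u => 'D_(ebase (s i)) f u) \o e by exact: IH.
by apply/funext => u /=; rewrite /derive E.
Qed.

End Calculus.

Section Charts.
Context {R : realType} {n : nat} {M : topologicalType}.

Record chart := Chart {
  chart_dom : set M;
  chart_fwd : M -> 'rV[R]_n;
  chart_bwd : 'rV[R]_n -> M;
  chart_dom_open : open chart_dom;
  chart_img_open : open (chart_fwd @` chart_dom);
  chart_fwd_cont : forall x, chart_dom x -> {for x, continuous chart_fwd};
  chart_bwd_cont : forall x, chart_dom x ->
    {for chart_fwd x, continuous chart_bwd};
  chart_fwdK : forall x, chart_dom x -> chart_bwd (chart_fwd x) = x }.

Arguments chart_dom_open : clear implicits.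
Arguments chart_img_open : clear implicits.

Definition coord (phi : chart) (i : 'I_n) (x : M) : R := chart_fwd phi x 0 i.

Definition smooth_transition (phi psi : chart) : Prop :=
  forall i, smooth_on (chart_fwd phi @` (chart_dom phi `&` chart_dom psi))
                      (coord psi i \o chart_bwd phi).

Lemma chart_image_open (phi : chart) (V : set M) :
  open V -> open (chart_fwd phi @` (V `&` chart_dom phi)).
Proof.
move=> oV; rewrite openE => _ [x [Vx dx] <-]; rewrite /interior.
have ox := open_nbhs_nbhs (conj (chart_img_open phi) (imageP (chart_fwd phi) dx)).
have bV : nbhs (chart_fwd phi x) (chart_bwd phi @^-1` V).
  apply: (@chart_bwd_cont phi x dx V); rewrite chart_fwdK //.
  exact: open_nbhs_nbhs.
apply: filterS2 ox bV => _ [y dy <-] Vy.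
by exists y => //; split=> //; rewrite -(chart_fwdK dy).
Qed.

End Charts.
Arguments chart : clear implicits.
Arguments chart_dom_open {R n M} _.
Arguments chart_img_open {R n M} _.

HB.mixin Record Topological_isManifold (R : realType) (n : nat) M
    & Topological M := {
  atlas : set (chart R n M);
  atlas_cover : forall x : M, exists2 phi, atlas phi & chart_dom phi x;
  atlas_smooth : forall phi psi, atlas phi -> atlas psi ->
    smooth_transition phi psi;
  manifold_hausdorff : hausdorff_space M;
  manifold_second_countable : @second_countable M }.

#[short(type="manifoldType")]
HB.structure Definition Manifold (R : realType) (n : nat) :=
  {M of Topological M & Topological_isManifold R n M}.

Arguments atlas {R n} s.
Arguments atlas_cover {R n s} x.

(* [phi] belongs to the maximal atlas. *)
Definition smooth_chart {R : realType} {n} {M : manifoldType R n}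
    (phi : chart R n M) : Prop :=
  forall psi, atlas M psi ->
    smooth_transition phi psi /\ smooth_transition psi phi.

Section SmoothFunctions.
Context {R : realType} {n : nat} {M : manifoldType R n}.
Implicit Types (f h : M -> R) (x : M) (V : set M).

Definition smooth_in V f : Prop := forall phi, atlas M phi ->
  smooth_on (chart_fwd phi @` (V `&` chart_dom phi)) (f \o chart_bwd phi).

Definition smooth_at f x : Prop :=
  exists V, [/\ open V, V x & smooth_in V f].

Definition smooth f : Prop := forall x, smooth_at f x.

Lemma smooth_in_sub V W f : V `<=` W -> smooth_in W f -> smooth_in V f.
Proof.
move=> VW sf phi aphi k; apply: Ck_sub (sf phi aphi k).
by move=> _ [x [Vx dx] <-]; exists x => //; split=> //; exact: VW.
Qed.

Lemma smooth_at2 f h x : smooth_at f x -> smooth_at h x ->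
  exists V, [/\ open V, V x, smooth_in V f & smooth_in V h].
Proof.
move=> [V [oV Vx sf]] [W [oW Wx sh]]; exists (V `&` W); split=> //.
- exact: openI.
- by apply: smooth_in_sub sf => y [].
- by apply: smooth_in_sub sh => y [].
Qed.

Lemma smooth_at_near f x : smooth_at f x -> \near x, smooth_at f x.
Proof.
move=> [V [oV Vx sf]]; apply: filterS (open_nbhs_nbhs (conj oV Vx)) => y Vy.
by exists V.
Qed.

Lemma smooth_at_eq f h x :
  (\near x, f x = h x) -> smooth_at f x -> smooth_at h x.
Proof.
move=> fh [V [oV Vx sf]]; exists (V `&` interior [set y | f y = h y]); split.
- by apply: openI => //; exact: open_interior.
- by split.
move=> phi aphi k.
have := Ck_sub _ (sf phi aphi k) => /(_ (chart_fwd phi @`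
   (V `&` interior [set y | f y = h y] `&` chart_dom phi))) H.
apply: Ck_eq (H _).
- by apply: chart_image_open; apply: openI => //; exact: open_interior.
- move=> _ [y [[Vy fhy] dy] <-] /=; rewrite chart_fwdK //.
  exact: (interior_subset fhy).
- by move=> _ [y [[Vy fhy] dy] <-]; exists y.
Qed.

Lemma smooth_at_cst (a : R) x : smooth_at (fun=> a) x.
Proof.
exists setT; split=> //; first exact: openT.
by move=> phi _ k; exact: Ck_cst.
Qed.

Lemma smooth_atD f h x :
  smooth_at f x -> smooth_at h x -> smooth_at (fun y => f y + h y) x.
Proof.
move=> sf sh; have [V [oV Vx {}sf {}sh]] := smooth_at2 sf sh.
exists V; split=> // phi aphi k.
by apply: CkD; [exact: chart_image_open|exact: sf|exact: sh].
Qed.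

Lemma smooth_atM f h x :
  smooth_at f x -> smooth_at h x -> smooth_at (fun y => f y * h y) x.
Proof.
move=> sf sh; have [V [oV Vx {}sf {}sh]] := smooth_at2 sf sh.
exists V; split=> // phi aphi k.
by apply: CkM; [exact: chart_image_open|exact: sf|exact: sh].
Qed.

Lemma smooth_atZD (a : R) f h x :
  smooth_at f x -> smooth_at h x -> smooth_at (fun y => a * f y + h y) x.
Proof.
by move=> sf; apply: smooth_atD; apply: smooth_atM => //; exact: smooth_at_cst.
Qed.

End SmoothFunctions.

Section CInf.
Context {R : realType} {n : nat} (M : manifoldType R n).

Definition cinf_pred : {pred M -> R} := fun f => `[< smooth f >].

Lemma cinf_submod : submod_closed (cinf_pred : {pred M -> R^o}).
Proof.
split; first by apply/asboolP => x; exact: smooth_at_cst.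
move=> a f h /asboolP sf /asboolP sh; apply/asboolP => x.
exact: smooth_atZD.
Qed.

HB.instance Definition _ :=
  GRing.isSubmodClosed.Build R (M -> R^o) cinf_pred cinf_submod.

Record cinf := Cinf { cinf_fun :> M -> R^o; _ : cinf_fun \in cinf_pred }.

HB.instance Definition _ := [isSub for cinf_fun].
HB.instance Definition _ := [Choice of cinf by <:].
HB.instance Definition _ := [SubChoice_isSubLmodule of cinf by <:].

Lemma cinf_smooth (f : cinf) : smooth f.
Proof. by case: f => f /= /asboolP. Qed.

End CInf.

Section Tangent.
Context {R : realType} {n : nat} {M : manifoldType R n}.

(* Derivations at [x] of the algebra of germs of smooth functions; they are
   extended by 0 to functions that are not smooth near [x], so that equal
   derivations are equal as functions.                                       *)
Definition derivation_at (x : M) (v : (M -> R) -> R^o) : Prop :=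
  [/\ forall f, ~ smooth_at f x -> v f = 0,
      forall f h, smooth_at f x -> (\near x, f x = h x) -> v f = v h,
      forall a f h, smooth_at f x -> smooth_at h x ->
        v (fun y => a * f y + h y) = a * v f + v h
    & forall f h, smooth_at f x -> smooth_at h x ->
        v (fun y => f y * h y) = f x * v h + h x * v f].

Definition derivation_pred x : {pred (M -> R) -> R^o} :=
  fun v => `[< derivation_at x v >].

Lemma derivation_submod x : submod_closed (derivation_pred x).
Proof.
split; first by apply/asboolP; split=> // *; rewrite /= ?mulr0 ?addr0.
move=> b v w /asboolP[v0 vg vl vM] /asboolP[w0 wg wl wM]; apply/asboolP.
have E f : (b *: v + w) f = b * v f + w f by [].
split=> [f nf|f h sf fh|a f h sf sh|f h sf sh]; rewrite !E.
- by rewrite v0 // w0 // mulr0 addr0.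
- by rewrite (vg f h) // (wg f h).
- by rewrite vl // wl //; ring.
- by rewrite vM // wM //; ring.
Qed.

HB.instance Definition _ x :=
  GRing.isSubmodClosed.Build R ((M -> R) -> R^o) (derivation_pred x)
    (derivation_submod x).

Record tangent x := Tangent {
  tangent_fun :> (M -> R) -> R^o;
  tangentP : tangent_fun \in derivation_pred x }.

HB.instance Definition _ x := [isSub for @tangent_fun x].
HB.instance Definition _ x := [Choice of tangent x by <:].
HB.instance Definition _ x := [SubChoice_isSubLmodule of tangent x by <:].

Lemma tangent_out x (v : tangent x) f : ~ smooth_at f x -> v f = 0.
Proof. by case: v => v /= /asboolP[H _ _ _]; exact: H. Qed.

Lemma tangent_near x (v : tangent x) f h :
  smooth_at f x -> (\near x, f x = h x) -> v f = v h.
Proof. by case: v => v /= /asboolP[_ H _ _]; exact: H. Qed.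

Lemma tangentZD x (v : tangent x) a f h : smooth_at f x -> smooth_at h x ->
  v (fun y => a * f y + h y) = a * v f + v h.
Proof. by case: v => v /= /asboolP[_ _ H _]; exact: H. Qed.

Lemma tangentM x (v : tangent x) f h : smooth_at f x -> smooth_at h x ->
  v (fun y => f y * h y) = f x * v h + h x * v f.
Proof. by case: v => v /= /asboolP[_ _ _ H]; exact: H. Qed.

Lemma tangent_lin x a (v w : tangent x) f : (a *: v + w) f = a * v f + w f.
Proof. by []. Qed.

Lemma tangent_eq x (v w : tangent x) : (forall f, smooth_at f x -> v f = w f) -> v = w.
Proof.
move=> vw; apply/val_inj/funext => f /=.
by have [/vw//|nf] := pselect (smooth_at f x); rewrite !tangent_out.
Qed.

Lemma tangentD x (v : tangent x) f h : smooth_at f x -> smooth_at h x ->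
  v (fun y => f y + h y) = v f + v h.
Proof.
move=> sf sh; rewrite -[v f]mul1r -tangentZD //.
by congr (v _); apply/funext => y; rewrite mul1r.
Qed.

End Tangent.

(* Not necessarily smooth sections of a family of vector spaces. *)
Section Sections.
Context {R : realType} {M : Type}.
Variable V : M -> lmodType R.

Definition section := forall x : M, V x.

HB.instance Definition _ := gen_eqMixin section.
HB.instance Definition _ := gen_choiceMixin section.

Let add (s t : section) : section := fun x => s x + t x.
Let zero : section := fun x => 0.
Let opp (s : section) : section := fun x => - s x.
Let scale (a : R) (s : section) : section := fun x => a *: s x.

Let addA : associative add.
Proof. by move=> s t u; apply: functional_extensionality_dep => x; exact: addrA. Qed.
Let addC : commutative add.
Proof. by move=> s t; apply: functional_extensionality_dep => x; exact: addrC. Qed.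
Let add0 : left_id zero add.
Proof. by move=> s; apply: functional_extensionality_dep => x; exact: add0r. Qed.
Let addN : left_inverse zero opp add.
Proof. by move=> s; apply: functional_extensionality_dep => x; exact: addNr. Qed.

HB.instance Definition _ := GRing.isZmodule.Build section addA addC add0 addN.

Let scaleA a b s : scale a (scale b s) = scale (a * b) s.
Proof. by apply: functional_extensionality_dep => x; exact: scalerA. Qed.
Let scale1 : left_id 1 scale.
Proof. by move=> s; apply: functional_extensionality_dep => x; exact: scale1r. Qed.
Let scaleDr : right_distributive scale +%R.
Proof. by move=> a s t; apply: functional_extensionality_dep => x; exact: scalerDr. Qed.
Let scaleDl s : {morph scale^~ s : a b / a + b}.
Proof. by move=> a b; apply: functional_extensionality_dep => x; exact: scalerDl. Qed.

HB.instance Definition _ := GRing.Zmodule_isLmodule.Build R section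
  scaleA scale1 scaleDr scaleDl.

End Sections.

Section VectorFields.
Context {R : realType} {n : nat} (M : manifoldType R n).

Definition vfield_pred : {pred section (fun x : M => tangent x : lmodType R)} :=
  fun X => `[< forall f x, smooth_at f x -> smooth_at (fun y => X y f) x >].

Lemma vfield_submod : submod_closed vfield_pred.
Proof.
split; first by apply/asboolP => f x _; exact: smooth_at_cst.
move=> a X Y /asboolP sX /asboolP sY; apply/asboolP => f x sf.
apply: (@smooth_atZD _ _ _ a (fun y => X y f) (fun y => Y y f)).
  exact: sX.
exact: sY.
Qed.

HB.instance Definition _ := GRing.isSubmodClosed.Build R _ vfield_pred vfield_submod.

Record vfield := VField {
  vfield_sec : section (fun x : M => tangent x : lmodType R);
  vfieldP : vfield_sec \in vfield_pred }.

HB.instance Definition _ := [isSub for vfield_sec].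
HB.instance Definition _ := [Choice of vfield by <:].
HB.instance Definition _ := [SubChoice_isSubLmodule of vfield by <:].

Definition vfield_at (X : vfield) (x : M) : tangent x := vfield_sec X x.
Coercion vfield_at : vfield >-> Funclass.

Lemma vfield_smooth (X : vfield) f x : smooth_at f x -> smooth_at (fun y => X y f) x.
Proof. by case: X => X /= /asboolP; exact. Qed.

End VectorFields.

Section Bracket.
Context {R : realType} {n : nat} {M : manifoldType R n}.
Implicit Types X Y : vfield M.

Definition bracket_fun X Y (x : M) (f : M -> R) : R :=
  if pselect (smooth_at f x) then X x (fun y => Y y f) - Y x (fun y => X y f)
  else 0.

Lemma bracket_funE X Y x f : smooth_at f x ->
  bracket_fun X Y x f = X x (fun y => Y y f) - Y x (fun y => X y f).
Proof. by rewrite /bracket_fun; case: pselect. Qed.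

Lemma bracket_derivation X Y x : bracket_fun X Y x \in derivation_pred x.
Proof.
have ZD (Z : vfield M) (a : R) (f h : M -> R) : smooth_at f x -> smooth_at h x ->
    \near x, Z x (fun y => a * f y + h y) = a * Z x f + Z x h.
  move=> /smooth_at_near sf /smooth_at_near sh.
  by apply: filterS2 sf sh => y sfy shy; apply: tangentZD.
have ZM (Z : vfield M) (f h : M -> R) : smooth_at f x -> smooth_at h x ->
    \near x, Z x (fun y => f y * h y) = f x * Z x h + h x * Z x f.
  move=> /smooth_at_near sf /smooth_at_near sh.
  by apply: filterS2 sf sh => y sfy shy; apply: tangentM.
have Zs (Z : vfield M) (f : M -> R) : smooth_at f x -> smooth_at (fun y => Z y f) x.
  exact: vfield_smooth.
apply/asboolP; split=> [f nf|f h sf fh|a f h sf sh|f h sf sh].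
- by rewrite /bracket_fun; case: pselect.
- have sh : smooth_at h x by exact: smooth_at_eq sf.
  rewrite !bracket_funE //.
  have E (Z : vfield M) : \near x, Z x f = Z x h.
    by apply: filterS2 (smooth_at_near sf) (nbhs_interior fh) => y; exact: tangent_near.
  by rewrite (tangent_near _ (Zs Y f sf) (E Y)) (tangent_near _ (Zs X f sf) (E X)).
- have sfh := smooth_atZD a sf sh.
  rewrite !bracket_funE //.
  rewrite (tangent_near _ (Zs Y _ sfh) (ZD Y a f h sf sh)).
  rewrite (tangent_near _ (Zs X _ sfh) (ZD X a f h sf sh)).
  by rewrite !tangentZD; [ring|exact: Zs..].
- have sfh := smooth_atM sf sh.
  rewrite !bracket_funE //.
  rewrite (tangent_near _ (Zs Y _ sfh) (ZM Y f h sf sh)).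
  rewrite (tangent_near _ (Zs X _ sfh) (ZM X f h sf sh)).
  rewrite !tangentD ?tangentM; [ring|by [|exact: Zs|apply: smooth_atM => //; exact: Zs]..].
Qed.

Definition bracket_sec X Y : section (fun x : M => tangent x : lmodType R) :=
  fun x => Tangent (bracket_derivation X Y x).

Lemma bracket_smooth X Y : bracket_sec X Y \in @vfield_pred R n M.
Proof.
apply/asboolP => f x sf.
apply: (@smooth_at_eq _ _ _
  (fun y => (-1) * Y y (fun z => X z f) + X y (fun z => Y z f))).
  apply: filterS (smooth_at_near sf) => y sfy /=.
  by rewrite bracket_funE // addrC mulN1r.
by apply: smooth_atZD; do 2!apply: vfield_smooth.
Qed.

Definition bracket X Y : vfield M := VField (bracket_smooth X Y).

End Bracket.
Section SmoothMaps.
Context {R : realType} {n n' : nat} (M : manifoldType R n) (N : manifoldType R n').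

Record smap := SMap {
  smap_fun :> M -> N;
  smap_cont : continuous smap_fun;
  smap_smooth : forall x h, smooth_at h (smap_fun x) ->
    smooth_at (h \o smap_fun) x }.

Variable F : smap.

Definition push_fun x (v : tangent x) (h : N -> R) : R :=
  if pselect (smooth_at h (F x)) then v (h \o F) else 0.

Lemma push_funE x (v : tangent x) h :
  smooth_at h (F x) -> push_fun v h = v (h \o F).
Proof. by rewrite /push_fun; case: pselect. Qed.

Lemma push_derivation x (v : tangent x) : push_fun v \in derivation_pred (F x).
Proof.
apply/asboolP; split=> [h nh|h k sh hk|a h k sh sk|h k sh sk].
- by rewrite /push_fun; case: pselect.
- rewrite !push_funE //; last exact: smooth_at_eq sh.
  by apply: tangent_near; [exact: smap_smooth|exact: (smap_cont hk)].
- rewrite !push_funE //; last exact: smooth_atZD.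
  by rewrite -tangentZD //; exact: smap_smooth.
- rewrite !push_funE //; last exact: smooth_atM.
  by rewrite -(tangentM v (f := h \o F) (h := k \o F)) //; exact: smap_smooth.
Qed.

Definition differential x (v : tangent x) : tangent (F x) :=
  Tangent (push_derivation v).

End SmoothMaps.
Arguments differential {R n n' M N} F {x} v.

Section Binary.
Context {R : realType} {n n' : nat} {M : manifoldType R n} {N : manifoldType R n'}.

(* Smoothness on the product manifold, whose charts are the products of a
   chart of [M] and a chart of [N].                                          *)
Definition smooth2_in (V : set (M * N)) (f : M * N -> R) : Prop :=
  forall phi psi, atlas M phi -> atlas N psi ->
  smooth_on
    [set row_mx (chart_fwd phi z.1) (chart_fwd psi z.2) |
      z in V `&` (chart_dom phi `*` chart_dom psi)]
    (fun u => f (chart_bwd phi (lsubmx u), chart_bwd psi (rsubmx u))).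

Definition smooth2_at (f : M * N -> R) (z : M * N) : Prop :=
  exists V, [/\ open V, V z & smooth2_in V f].

Lemma row_mx_contl (c : 'rV[R]_n') :
  continuous (fun u : 'rV[R]_n => row_mx u c).
Proof.
move=> u A [P Pu sP]; exists (fun i j => P i (lshift n' j)).
  by move=> i j; have := Pu i (lshift n' j); rewrite row_mxEl.
move=> v Pv; apply: sP => i j; rewrite !mxE.
case: (splitP j) => k jk.
  by have -> : j = lshift n' k by exact/val_inj.
have -> : j = rshift n k by exact/val_inj.
by have := nbhs_singleton (Pu i (rshift n k)); rewrite row_mxEr.
Qed.

Lemma row_mx_contr (c : 'rV[R]_n) :
  continuous (fun u : 'rV[R]_n' => row_mx c u).
Proof.
move=> u A [P Pu sP]; exists (fun i j => P i (rshift n j)).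
  by move=> i j; have := Pu i (rshift n j); rewrite row_mxEr.
move=> v Pv; apply: sP => i j; rewrite !mxE.
case: (splitP j) => k jk; last first.
  by have -> : j = rshift n k by exact/val_inj.
have -> : j = lshift n' k by exact/val_inj.
by have := nbhs_singleton (Pu i (lshift n' k)); rewrite row_mxEl.
Qed.

Lemma pairl_cont (y : N) : continuous (fun x : M => (x, y)).
Proof. by move=> x; apply: cvg_pair; [exact: cvg_id|exact: cvg_cst]. Qed.

Lemma pairr_cont (x : M) : continuous (fun y : N => (x, y)).
Proof. by move=> y; apply: cvg_pair; [exact: cvg_cst|exact: cvg_id]. Qed.

Lemma smooth2_sliceL f x y : smooth2_at f (x, y) -> smooth_at (fun x' => f (x', y)) x.
Proof.
move=> [V [oV Vxy sf]]; have [psi apsi dy] := @atlas_cover _ _ N y.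
exists [set x' | V (x', y)]; split=> //.
  by move/continuousP: (@pairl_cont y); apply.
move=> phi aphi k.
have he (u : 'rV[R]_n) (h : R) i : row_mx (h *: ebase i + u) (chart_fwd psi y) =
    h *: ebase (lshift n' i) + row_mx u (chart_fwd psi y).
  rewrite /ebase -[delta_mx 0 (lshift n' i)]hsubmxK.
  rewrite scale_row_mx add_row_mx; congr row_mx; apply/rowP => j; rewrite !mxE.
    by rewrite (inj_eq (@lshift_inj _ _)).
  by rewrite eq_rlshift andbF mulr0 add0r.
have := Ck_slice (@row_mx_contl _) he (sf phi psi aphi apsi k).
set g := (X in Ck _ _ X).
have -> : g = (fun u => f (chart_bwd phi u, y)).
  by apply/funext => u; rewrite /g /= row_mxKl row_mxKr chart_fwdK.
by apply: Ck_sub => _ [x' [Vx' dx'] <-]; exists (x', y).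
Qed.

Lemma smooth2_sliceR f x y : smooth2_at f (x, y) -> smooth_at (fun y' => f (x, y')) y.
Proof.
move=> [V [oV Vxy sf]]; have [phi aphi dx] := @atlas_cover _ _ M x.
exists [set y' | V (x, y')]; split=> //.
  by move/continuousP: (@pairr_cont x); apply.
move=> psi apsi k.
have he (u : 'rV[R]_n') (h : R) i : row_mx (chart_fwd phi x) (h *: ebase i + u) =
    h *: ebase (rshift n i) + row_mx (chart_fwd phi x) u.
  rewrite /ebase -[delta_mx 0 (rshift n i)]hsubmxK.
  rewrite scale_row_mx add_row_mx; congr row_mx; apply/rowP => j; rewrite !mxE.
    by rewrite eq_lrshift andbF mulr0 add0r.
  by rewrite (inj_eq (@rshift_inj _ _)).
have := Ck_slice (@row_mx_contr _) he (sf phi psi aphi apsi k).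
set g := (X in Ck _ _ X).
have -> : g = (fun u => f (x, chart_bwd psi u)).
  by apply/funext => u; rewrite /g /= row_mxKl row_mxKr chart_fwdK.
by apply: Ck_sub => _ [y' [Vy' dy'] <-]; exists (x, y').
Qed.

End Binary.

Definition smooth_binary {R : realType} {n1 n2 n3}
    {M1 : manifoldType R n1} {M2 : manifoldType R n2} {N : manifoldType R n3}
    (F : M1 -> M2 -> N) : Prop :=
  continuous (fun z => F z.1 z.2) /\
  forall z h, smooth_at h (F z.1 z.2) -> smooth2_at (fun z => h (F z.1 z.2)) z.

HB.structure Definition ManifoldGroup (R : realType) (n : nat) :=
  {G of Group G & Manifold R n G}.

HB.mixin Record ManifoldGroup_isLie (R : realType) (n : nat) G
    & ManifoldGroup R n G := {
  mulg_smooth : smooth_binary (fun a b : G => (a * b)%g);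
  invg_cont : continuous (fun a : G => (a^-1)%g);
  invg_smooth : forall (a : G) h, smooth_at h (a^-1)%g ->
    smooth_at (fun b : G => h (b^-1)%g) a }.

#[short(type="lieGroupType")]
HB.structure Definition LieGroup (R : realType) (n : nat) :=
  {G of ManifoldGroup R n G & ManifoldGroup_isLie R n G}.
Section LieAlgebra.
Context {R : realType} {p : nat} (G : lieGroupType R p).

Lemma ltrans_cont (a : G) : continuous (fun b : G => (a * b)%g).
Proof.
move=> b; apply: (@continuous_comp _ _ _ (fun b : G => (a, b)) (fun z => (z.1 * z.2)%g)).
  exact: pairr_cont.
exact: (proj1 (@mulg_smooth R p G)).
Qed.

Lemma ltrans_smooth (a b : G) h :
  smooth_at h (a * b)%g -> smooth_at (fun c : G => h (a * c)%g) b.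
Proof.
by move=> sh; have := smooth2_sliceR (proj2 (@mulg_smooth R p G) (a, b) h sh).
Qed.

Definition ltrans (a : G) : smap G G := SMap (@ltrans_cont a) (@ltrans_smooth a).

Definition left_invariant (X : vfield G) : Prop :=
  forall a b : G, differential (ltrans a) (X b) = X (a * b)%g.

Definition lie_pred : {pred vfield G} := fun X => `[< left_invariant X >].

Lemma left_invariantP (X : vfield G) : left_invariant X <->
  forall (a b : G) h, smooth_at h (a * b)%g ->
    X (a * b)%g h = X b (fun c => h (a * c)%g).
Proof.
split=> [XL a b h sh|XL a b]; first by rewrite -XL /= push_funE.
by apply: tangent_eq => h sh; rewrite /= push_funE // XL.
Qed.

Lemma lie_submod : submod_closed lie_pred.
Proof.
split; first by apply/asboolP/left_invariantP.
move=> k X Y /asboolP/left_invariantP XL /asboolP/left_invariantP YL.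
apply/asboolP/left_invariantP => a b h sh.
change (k * X (a * b)%g h + Y (a * b)%g h =
  k * X b (fun c => h (a * c)%g) + Y b (fun c => h (a * c)%g)).
by rewrite XL // YL.
Qed.

Lemma bracket_left_invariant (X Y : vfield G) :
  left_invariant X -> left_invariant Y -> left_invariant (bracket X Y).
Proof.
move=> /left_invariantP XL /left_invariantP YL; apply/left_invariantP => a b h sh /=.
have sh' := ltrans_smooth sh; rewrite !bracket_funE //.
rewrite XL; last exact: vfield_smooth.
rewrite YL; last exact: vfield_smooth.
have near_h : \near b, smooth_at h (a * b)%g.
  exact: ltrans_cont (smooth_at_near sh).
congr (_ - _); apply: tangent_near.
- exact: (ltrans_smooth (vfield_smooth Y sh)).
- by apply: filterS near_h => c sc; rewrite YL.
- exact: (ltrans_smooth (vfield_smooth X sh)).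
- by apply: filterS near_h => c sc; rewrite XL.
Qed.

HB.instance Definition _ := GRing.isSubmodClosed.Build R _ lie_pred lie_submod.

Record lie_algebra := LieAlg {
  lie_field :> vfield G; lie_fieldP : lie_field \in lie_pred }.

HB.instance Definition _ := [isSub for lie_field].
HB.instance Definition _ := [Choice of lie_algebra by <:].
HB.instance Definition _ := [SubChoice_isSubLmodule of lie_algebra by <:].

Lemma lie_bracket_proof (X Y : lie_algebra) : bracket X Y \in lie_pred.
Proof.
case: X Y => X XL [Y YL] /=.
by apply/asboolP/bracket_left_invariant; apply/asboolP.
Qed.

Definition lie_bracket X Y : lie_algebra := LieAlg (lie_bracket_proof X Y).

End LieAlgebra.

Section Actions.
Context {R : realType} {p n : nat} (G : lieGroupType R p) (M : manifoldType R n).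

Record lie_action := LieAction {
  act :> G -> M -> M;
  act1 : forall x, act 1%g x = x;
  actM : forall a b x, act (a * b)%g x = act a (act b x);
  act_smooth : smooth_binary act }.

Variable A : lie_action.

Lemma act_cont a : continuous (A a).
Proof.
move=> x; apply: (@continuous_comp _ _ _ (fun x : M => (a, x)) (fun z => A z.1 z.2)).
  exact: pairr_cont.
exact: (proj1 (act_smooth A)).
Qed.

Lemma act_smooth_at a x h : smooth_at h (A a x) -> smooth_at (h \o A a) x.
Proof.
by move=> sh; have := smooth2_sliceR (proj2 (act_smooth A) (a, x) h sh).
Qed.

Definition act_smap a : smap M M := SMap (@act_cont a) (@act_smooth_at a).

Lemma orbit_cont x : continuous (fun a : G => A a x).
Proof.
move=> a; apply: (@continuous_comp _ _ _ (fun a : G => (a, x)) (fun z => A z.1 z.2)).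
  exact: pairl_cont.
exact: (proj1 (act_smooth A)).
Qed.

Lemma orbit_smooth x a h :
  smooth_at h (A a x) -> smooth_at (h \o fun a : G => A a x) a.
Proof.
by move=> sh; have := smooth2_sliceL (proj2 (act_smooth A) (a, x) h sh).
Qed.

Definition orbit_smap x : smap G M := SMap (@orbit_cont x) (@orbit_smooth x).

(* X_x = d/dt exp(tX)x at t = 0; the cast is along [act1].  For this left
   action, [X |-> fundamental X] sends the bracket of left invariant fields
   to the opposite of the bracket of fields on [M].                          *)
Definition fundamental (X : lie_algebra G) (x : M) : tangent x :=
  ecast y (tangent y) (act1 A x) (differential (orbit_smap x) (X 1%g)).

End Actions.

Section ExteriorPower.
Context {R : realType} {V : lmodType R} (k : nat).

Definition upd (v : 'I_k -> V) i u : 'I_k -> V := fun j => if j == i then u else v j.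

Definition alternating (alpha : ('I_k -> V) -> R^o) : Prop :=
  (forall v i a u w,
     alpha (upd v i (a *: u + w)) = a * alpha (upd v i u) + alpha (upd v i w)) /\
  (forall v i j, i != j -> v i = v j -> alpha v = 0).

(* The exterior power Lambda^k V of a finite dimensional space, as the dual of
   the space of alternating k-forms; a functional is extended by 0 to maps
   that are not alternating forms.                                           *)
Definition extpow_pred : {pred (('I_k -> V) -> R^o) -> R^o} := fun w =>
  `[< (forall alpha, ~ alternating alpha -> w alpha = 0) /\
      (forall a alpha beta, alternating alpha -> alternating beta ->
         w (a *: alpha + beta) = a * w alpha + w beta) >].

Lemma extpow_submod : submod_closed extpow_pred.
Proof.
split; first by apply/asboolP; split=> // *; rewrite mulr0 addr0.
move=> b v w /asboolP[v0 vl] /asboolP[w0 wl]; apply/asboolP.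
have E f : (b *: v + w) f = b * v f + w f by [].
split=> [f nf|a f h sf sh]; rewrite !E.
- by rewrite v0 // w0 // mulr0 addr0.
- by rewrite vl // wl //; ring.
Qed.

HB.instance Definition _ := GRing.isSubmodClosed.Build R
  ((('I_k -> V) -> R^o) -> R^o) extpow_pred extpow_submod.

Record extpow := ExtPow {
  extpow_fun :> (('I_k -> V) -> R^o) -> R^o;
  extpowP : extpow_fun \in extpow_pred }.

HB.instance Definition _ := [isSub for extpow_fun].
HB.instance Definition _ := [Choice of extpow by <:].
HB.instance Definition _ := [SubChoice_isSubLmodule of extpow by <:].

Lemma extpow_out (w : extpow) alpha : ~ alternating alpha -> w alpha = 0.
Proof. by case: w => w /= /asboolP[H _]; exact: H. Qed.

Lemma extpow_linear (w : extpow) a alpha beta :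
  alternating alpha -> alternating beta ->
  w (a *: alpha + beta) = a * w alpha + w beta.
Proof. by case: w => w /= /asboolP[_ H]; exact: H. Qed.

Lemma alternatingZ a alpha : alternating alpha -> alternating (a *: alpha).
Proof.
move=> [lin alt]; have E v : (a *: alpha) v = a * alpha v by [].
split=> [v i b u w|v i j ij vij]; rewrite !E; first by rewrite lin; ring.
by rewrite (alt v i j) ?mulr0.
Qed.

Lemma extpow_scale (w : extpow) a alpha : a != 0 -> w (a *: alpha) = a * w alpha.
Proof.
move=> a0; have [Aa|nAa] := pselect (alternating alpha).
  have A0 : alternating (0 : ('I_k -> V) -> R^o).
    by split=> // *; rewrite mulr0 addr0.
  have w00 : w 0 = 0.
    have := extpow_linear w 1 A0 A0; rewrite scale1r addr0 mul1r => /eqP.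
    by rewrite -subr_eq0 opprD addrA subrr sub0r oppr_eq0 => /eqP.
  by rewrite -[a *: alpha]addr0 extpow_linear // w00 addr0.
rewrite (extpow_out _ nAa) extpow_out ?mulr0 // => /(alternatingZ a^-1).
by rewrite scalerA mulVf // scale1r.
Qed.

Definition wedge_fun (v : 'I_k -> V) (alpha : ('I_k -> V) -> R^o) : R^o :=
  if pselect (alternating alpha) then alpha v else 0.

Lemma alternatingD a alpha beta : alternating alpha -> alternating beta ->
  alternating (a *: alpha + beta).
Proof.
move=> [lin alt] [lin' alt'].
have E v : (a *: alpha + beta) v = a * alpha v + beta v by [].
split=> [v i b u w|v i j ij vij]; rewrite !E; first by rewrite lin lin'; ring.
by rewrite (alt v i j) // (alt' v i j) // mulr0 addr0.
Qed.

Lemma wedge_proof v : wedge_fun v \in extpow_pred.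
Proof.
have E alpha : alternating alpha -> wedge_fun v alpha = alpha v.
  by rewrite /wedge_fun; case: pselect.
apply/asboolP; split=> [alpha nA|a alpha beta Aa Ab].
  by rewrite /wedge_fun; case: pselect.
by rewrite !E //; exact: alternatingD.
Qed.

(* v_0 /\ ... /\ v_(k-1) *)
Definition wedge (v : 'I_k -> V) : extpow := ExtPow (wedge_proof v).

(* The norm on Lambda^k V induced by an inner product [g]: it is given by
   |v_1 /\ ... /\ v_k|^2 = det (g(v_i, v_j)).                                *)
Definition ext_norm (g : V -> V -> R) (w : extpow) : R :=
  Num.sqrt (w (fun u => w (fun v => \det (\matrix_(i, j) g (v i) (u j))))).

Lemma ext_normZ g a w : ext_norm g (a *: w) = `|a| * ext_norm g w.
Proof.
have [->|a0] := eqVneq a 0.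
  by rewrite scale0r normr0 mul0r /ext_norm /= sqrtr0.
rewrite /ext_norm -sqrtr_sqr -sqrtrM ?sqr_ge0 //; congr Num.sqrt.
set b := fun u => w _.
change (a * w (a *: b) = a ^+ 2 * w b).
by rewrite extpow_scale // mulrA.
Qed.

End ExteriorPower.
Arguments extpow {R} V k.
Section DensityFibre.
Context {R : realType} (V : lmodType R) (n : nat) (t : R).

(* Maps l on Lambda^n V minus 0 with l(a w) = |a|^(-t/n) l(w), extended by
   l(0) = 0.                                                                 *)
Definition density_pred : {pred extpow V n -> R^o} := fun l =>
  `[< l 0 = 0 /\ forall a w, a != 0 -> w != 0 ->
        l (a *: w) = `|a| `^ (- t / n%:R) * l w >].

Lemma density_submod : submod_closed density_pred.
Proof.
split; first by apply/asboolP; split=> // *; rewrite mulr0.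
move=> b l m /asboolP[l0 lh] /asboolP[m0 mh]; apply/asboolP.
have E w : (b *: l + m) w = b * l w + m w by [].
split=> [|a w a0 w0]; rewrite !E; first by rewrite l0 m0 mulr0 addr0.
by rewrite lh // mh //; ring.
Qed.

HB.instance Definition _ := GRing.isSubmodClosed.Build R (extpow V n -> R^o)
  density_pred density_submod.

Record density := Density {
  density_fun :> extpow V n -> R^o; densityP : density_fun \in density_pred }.

HB.instance Definition _ := [isSub for density_fun].
HB.instance Definition _ := [Choice of density by <:].
HB.instance Definition _ := [SubChoice_isSubLmodule of density by <:].

Lemma density0 (l : density) : l 0 = 0.
Proof. by case: l => l /= /asboolP[]. Qed.

Lemma density_homog (l : density) a w : a != 0 -> w != 0 ->
  l (a *: w) = `|a| `^ (- t / n%:R) * l w.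
Proof. by case: l => l /= /asboolP[_]; exact. Qed.

Definition unit_density_fun (g : V -> V -> R) (w : extpow V n) : R^o :=
  if w == 0 then 0 else ext_norm g w `^ (- t / n%:R).

Lemma unit_density_proof g : unit_density_fun g \in density_pred.
Proof.
apply/asboolP; rewrite /unit_density_fun eqxx; split=> // a w a0 w0.
by rewrite scaler_eq0 (negbTE a0) (negbTE w0) /= ext_normZ powRM // sqrtr_ge0.
Qed.

Definition unit_density_at g : density := Density (unit_density_proof g).

End DensityFibre.

Section DensityMul.
Context {R : realType} (V : lmodType R) (n : nat).

Lemma density_mul_proof s t (l : density V n s) (m : density V n t) :
  (fun w => l w * m w : R^o) \in @density_pred R V n (s + t).
Proof.
apply/asboolP; split; first by rewrite density0 mul0r.
move=> a w a0 w0; rewrite !density_homog // opprD mulrDl powRD; last first.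
  by rewrite normr_eq0 a0 implybT.
by ring.
Qed.

Definition density_mul s t (l : density V n s) (m : density V n t) :
  density V n (s + t) := Density (density_mul_proof l m).

End DensityMul.

Section DensityBundle.
Context {R : realType} {n : nat} (M : manifoldType R n).

Definition Lbun (t : R) (x : M) : lmodType R := density (tangent x) n t.

Definition frame_at (X : 'I_n -> vfield M) (x : M) : Prop :=
  forall a : 'I_n -> R, \sum_i a i *: X i x = 0 -> forall i, a i = 0.

Definition smooth_section_pred t : {pred section (Lbun t)} := fun s =>
  `[< forall (X : 'I_n -> vfield M) x, frame_at X x ->
        smooth_at (fun y => (s y : density _ _ _) (wedge (fun i => X i y))) x >].

Lemma smooth_section_submod t : submod_closed (@smooth_section_pred t).
Proof.
split; first by apply/asboolP => X x _; exact: smooth_at_cst.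
move=> a s r /asboolP ss /asboolP sr; apply/asboolP => X x fX.
exact: (smooth_atZD a (ss X x fX) (sr X x fX)).
Qed.

HB.instance Definition _ t := GRing.isSubmodClosed.Build R (section (Lbun t))
  (@smooth_section_pred t) (smooth_section_submod t).

Record Gam t := GamSection {
  Gam_sec : section (Lbun t); GamP : Gam_sec \in @smooth_section_pred t }.

HB.instance Definition _ t := [isSub for @Gam_sec t].
HB.instance Definition _ t := [Choice of Gam t by <:].
HB.instance Definition _ t := [SubChoice_isSubLmodule of Gam t by <:].

Definition Gam_at t (s : Gam t) (x : M) : Lbun t x := Gam_sec s x.
Coercion Gam_at : Gam >-> Funclass.

Lemma fsec_proof t (f : cinf M) (s : Gam t) :
  (fun x => f x *: s x : Lbun t x) \in @smooth_section_pred t.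
Proof.
apply/asboolP => X x fX; have /asboolP ss := GamP s.
exact: (smooth_atM (cinf_smooth f x) (ss X x fX)).
Qed.

Definition fsec t (f : cinf M) (s : Gam t) : Gam t := GamSection (fsec_proof f s).

Lemma sec_mul_proof t r (s : Gam t) (u : Gam r) :
  (fun x => density_mul (s x) (u x) : Lbun (t + r) x)
    \in @smooth_section_pred (t + r).
Proof.
apply/asboolP => X x fX; have /asboolP ss := GamP s; have /asboolP su := GamP u.
exact: (smooth_atM (ss X x fX) (su X x fX)).
Qed.

(* the product L^t (x) L^r = L^(t + r) on sections *)
Definition sec_mul t r (s : Gam t) (u : Gam r) : Gam (t + r) :=
  GamSection (sec_mul_proof s u).

(* A connection, as a map from sections of L^t to L^t-valued 1-forms; on
   sections it is also the exterior covariant derivative.                    *)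
Record connection t := Connection {
  nabla :> Gam t -> forall x : M, tangent x -> Lbun t x;
  nabla_form : forall s x, linear (@nabla s x);
  nabla_add : forall s u x v, nabla (s + u) v = @nabla s x v + @nabla u x v;
  nabla_leibniz : forall f s x (v : tangent x),
    nabla (fsec f s) v = v f *: s x + f x *: @nabla s x v;
  nabla_smooth : forall s (X : vfield M),
    (fun x => nabla s (X x) : Lbun t x) \in @smooth_section_pred t }.

End DensityBundle.
Section Metrics.
Context {R : realType} {n : nat} (M : manifoldType R n).

Record metric := Metric {
  metric_form :> forall x : M, tangent x -> tangent x -> R^o;
  metric_linear : forall x v, linear (@metric_form x v);
  metric_sym : forall x v w, @metric_form x v w = @metric_form x w v;
  metric_pos : forall x v, v != 0 -> 0 < @metric_form x v v;
  metric_smooth : forall X Y : vfield M, smooth (fun x => metric_form (X x) (Y x)) }.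

(* l_g^t: as a density it is determined by l_g^t(w) = 1 for |w|_g = 1. *)
Definition unit_density (g : metric) (t : R) (x : M) : Lbun t x :=
  unit_density_at n t (@g x).

(* A conformal structure is given by its L^2-valued symmetric tensor
   c = g (x) l_g^2; the metrics of the conformal class are then the metrics g
   that satisfy this equation.                                               *)
Definition tensor2 := forall x : M, tangent x -> tangent x -> Lbun (2 : R) x.

Definition in_class (c : tensor2) (g : metric) : Prop :=
  forall x (v w : tangent x), c x v w = g x v w *: unit_density g 2 x.

Definition conformal_structure (c : tensor2) : Prop := exists g, in_class c g.

Definition form1 := forall x : M, tangent x -> R^o.
Definition form2 := forall x : M, tangent x -> tangent x -> R^o.

Definition smooth_form1 (w : form1) : Prop :=
  (forall x, linear (@w x)) /\ (forall X : vfield M, smooth (fun x => w x (X x))).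

Definition d1 (w : form1) (X Y : vfield M) (x : M) : R :=
  X x (fun y => w y (Y y)) - Y x (fun y => w y (X y)) - w x (bracket X Y x).

Definition d2 (W : form2) (X Y Z : vfield M) (x : M) : R :=
  X x (fun y => W y (Y y) (Z y)) - Y x (fun y => W y (X y) (Z y))
  + Z x (fun y => W y (X y) (Y y))
  - W x (bracket X Y x) (Z x) + W x (bracket X Z x) (Y x)
  - W x (bracket Y Z x) (X x).

Definition wedge12 (w : form1) (W : form2) (X Y Z : vfield M) (x : M) : R :=
  w x (X x) * W x (Y x) (Z x) - w x (Y x) * W x (X x) (Z x)
  + w x (Z x) * W x (X x) (Y x).

End Metrics.

Section LCK.
Context {R : realType} {m : nat} {M : manifoldType R (m + m)}.

Definition endo := forall x : M, tangent x -> tangent x.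

Implicit Types (J : endo) (c : tensor2 M) (g : metric M) (omega : form1 M).

(* [J] is the multiplication by i in local complex coordinates
   z_k = x_k + i y_k, the x_k being the first [m] real coordinates.          *)
Definition complex_structure J : Prop :=
  (forall x, linear (@J x)) /\
  forall x, exists phi : chart R (m + m) M,
    [/\ smooth_chart phi, chart_dom phi x
      & forall y (v : tangent y) (k : 'I_m), chart_dom phi y ->
          J y v (coord phi (lshift m k)) = - v (coord phi (rshift m k)) /\
          J y v (coord phi (rshift m k)) = v (coord phi (lshift m k))].

Definition hermitian J g : Prop :=
  forall x (v w : tangent x), g x (J x v) (J x w) = g x v w.

Definition kahler_form J g : form2 M := fun x v w => g x (J x v) w.

Definition lee_form J g omega : Prop :=
  [/\ smooth_form1 omega,
      forall (X Y : vfield M) x, d1 omega X Y x = 0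
    & forall (X Y Z : vfield M) x,
        d2 (kahler_form J g) X Y Z x = wedge12 omega (kahler_form J g) X Y Z x].

Definition lcK c J : Prop :=
  [/\ (1 < m)%N, complex_structure J, conformal_structure c
    & forall g, in_class c g -> hermitian J g /\ exists omega, lee_form J g omega].

Definition fundamental_form c J x (v w : tangent x) : Lbun (2 : R) x := c x (J x v) w.

Definition automorphism c J (F : smap M M) : Prop :=
  [/\ exists F' : smap M M, cancel F F' /\ cancel F' F,
      forall x (v : tangent x), differential F (J x v) = J (F x) (differential F v)
    & forall g, in_class c g -> exists2 g', in_class c g' &
        forall x (v w : tangent x),
          g' x v w = g (F x) (differential F v) (differential F w)].

(* A Lie subgroup of Aut(M) is encoded as a Lie group with a smooth effective
   action on [M] by automorphisms.                                           *)
Definition connected_subgroup_of_Aut c J p (G : lieGroupType R p)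
    (A : lie_action G M) : Prop :=
  [/\ connected [set: G],
      forall a b : G, (forall x, A a x = A b x) -> a = b
    & forall a : G, automorphism c J (act_smap A a)].

(* the connection induced on L^2 = L^1 (x) L^1 by a connection on L^1 *)
Definition induced_connection2 (D1 : connection M 1) (D2 : connection M 2) : Prop :=
  forall (s u : Gam M 1) x (v : tangent x),
    D2 (sec_mul s u) x v = density_mul (D1 s x v) (u x) + density_mul (s x) (D1 u x v)
    :> Lbun (2 : R) x.

(* nabla l_g = - 1/2 omega_g (x) l_g for every metric of the class *)
Definition canonical_Weyl c J (D : connection M 1) : Prop :=
  forall g omega (l : Gam M 1), in_class c g -> lee_form J g omega ->
    (forall x, l x = unit_density g 1 x) ->
    forall x (v : tangent x), D l x v = (- (2^-1 * omega x v)) *: l x.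

Section Momentum.
Context {p : nat} {G : lieGroupType R p} (A : lie_action G M).
Variables (c : tensor2 M) (J : endo).

Definition sharp x (alpha : tangent x -> Lbun (2 : R) x) : tangent x :=
  xget 0 [set v | forall w, fundamental_form c J v w = alpha w].

Definition poisson (D : connection M 2) (f1 f2 : Gam M 2) : section (Lbun 2) :=
  fun x => fundamental_form c J (sharp (D f1 x)) (sharp (D f2 x)).

Definition conformal_momentum_map (D : connection M 2)
    (mu : lie_algebra G -> Gam M 2) : Prop :=
  [/\ linear mu,
      forall X Y x, mu (lie_bracket X Y) x = poisson D (mu X) (mu Y) x
    & forall X x (v : tangent x),
        fundamental_form c J (fundamental A X x) v = D (mu X) x v].

Variables (g : metric M) (omega : form1 M).

Definition sharp_g x (alpha : tangent x -> R^o) : tangent x :=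
  xget 0 [set v | forall u, kahler_form J g v u = alpha u].

(* d^omega f = df - f omega *)
Definition twisted_d (f : cinf M) : form1 M := fun x v => v f - f x * @omega x v.

Definition poisson_g (f1 f2 : cinf M) (x : M) : R :=
  kahler_form J g (sharp_g (@twisted_d f1 x)) (sharp_g (@twisted_d f2 x)).

Definition metric_momentum_map (mu : lie_algebra G -> cinf M) : Prop :=
  [/\ linear mu,
      forall X Y x, mu (lie_bracket X Y) x = poisson_g (mu X) (mu Y) x
    & forall X x (v : tangent x),
        kahler_form J g (fundamental A X x) v = @twisted_d (mu X) x v].

End Momentum.

End LCK.
Arguments endo {R m} M.

(* Main.v *)
(* Write l for the density l_g of weight 1. The Weyl connection satisfies
   nabla l = -1/2 omega_g l, so by the Leibniz rule
   nabla (f l^2) = (df - f omega_g) l^2, while Omega = Omega_g l^2. Since l^2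
   vanishes nowhere, the two momentum equations, the two musical isomorphisms and
   hence the two brackets correspond to each other under f <-> f l^2.

   That l is a smooth section without zeros is seen on wedges of vectors, where
   l^t is a power of the Gram determinant, positive and smooth on frames. Every
   tangent space has enough independent derivations for this, namely the
   coordinate derivations of a chart. *)
Require Import Defs.
From HB Require Import structures.
From mathcomp Require Import all_boot all_order all_algebra.
From mathcomp Require Import all_classical all_reals all_analysis.
From mathcomp Require Import ring.

Set Implicit Arguments.
Unset Strict Implicit.
Unset Printing Implicit Defensive.

Import Order.TTheory GRing.Theory Num.Theory.
Import numFieldNormedType.Exports.

Local Open Scope classical_set_scope.
Local Open Scope ring_scope.

(* On the segment from the identity to [A] the determinant has no zero. *)
Lemma det_posdef_gt0 (R : rcfType) n (A : 'M[R]_n) :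
  (forall u : 'rV[R]_n, u != 0 -> 0 < (u *m A *m u^T) 0 0) -> 0 < \det A.
Proof.
(* [P] is the segment with the indeterminate as parameter: its determinant is a polynomial, to which
   the intermediate value theorem over a real closed field applies. *)
move=> Apos; pose P : 'M[{poly R}]_n := 1%:M + 'X *: map_mx polyC (A - 1%:M).
pose S t : 'M[R]_n := 1%:M + t *: (A - 1%:M).
have PE t : (\det P).[t] = \det (S t).
  rewrite -horner_evalE -det_map_mx; congr (\det _).
  apply/matrixP => i j; rewrite !mxE /= horner_evalE hornerD hornerM hornerX hornerC.
  by case: (i == j); rewrite ?mulr1n ?mulr0n hornerC.
have S1 : S 1 = A by rewrite /S scale1r addrC subrK.
rewrite -[A]S1 -PE ltNge; apply/negP => P1.
have [t /andP[t0 t1] /rootP] : exists2 t, 0 <= t <= 1 & root (- \det P) t.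
  apply: poly_ivt; first exact: ler01.
  by rewrite !hornerN oppr_le0 oppr_ge0 P1 PE /S scale0r addr0 det1 ler01.
rewrite hornerN PE => /eqP; rewrite oppr_eq0 => /det0P[u u0 uS].
have /eqP : (u *m S t *m u^T) 0 0 = 0 by rewrite uS mul0mx mxE.
apply/negP; rewrite gt_eqF // /S.
have uu : 0 < (u *m u^T) 0 0.
  have /rV0Pn[i ui] := u0; rewrite mxE (bigD1 i) //= mxE ltr_pwDl //.
    by rewrite -expr2 lt0r sqrf_eq0 ui sqr_ge0.
  by apply: sumr_ge0 => j _; rewrite mxE -expr2 sqr_ge0.
(* The form of [S t] at the null vector [u] is a convex combination of two positive numbers, so it
   cannot vanish. *)
have -> : u *m (1%:M + t *: (A - 1%:M)) *m u^T =
    (1 - t) *: (u *m u^T) + t *: (u *m A *m u^T).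
  rewrite mulmxDr mulmx1 -scalemxAr mulmxBr mulmx1 scalerBr mulmxDl mulmxBl.
  by rewrite -!scalemxAl scalerBl scale1r addrAC addrA.
rewrite !mxE; move: (Apos u u0) uu; rewrite !mxE => Au uu.
have [->|tn0] := eqVneq t 0; first by rewrite subr0 mul1r mul0r addr0.
by rewrite ltr_wpDl ?mulr_ge0 ?subr_ge0 ?(ltW uu) // mulr_gt0 // lt0r tn0.
Qed.

(** * Exterior norm and densities on wedges of vectors *)

Section WedgeNorm.
Context {R : realType} {V : lmodType R} (n : nat) (g : V -> V -> R^o).
Hypotheses (gl : forall v, linear (g v)) (gC : forall v w, g v w = g w v).
Hypothesis gpos : forall v, v != 0 -> 0 < g v v.

Definition gram (v w : 'I_n -> V) : 'M[R]_n := \matrix_(i, j) g (v i) (w j).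

Lemma gramC v w : gram v w = (gram w v)^T.
Proof. by apply/matrixP => i j; rewrite !mxE gC. Qed.

(** Elements of [extpow] vanish by default on maps that are not alternating, so this is what gives
    them access to Gram determinants. *)
Lemma det_gram_alternating w : Defs.alternating (fun v => \det (gram v w) : R^o).
Proof.
split=> [v i a u u'|v i j ij vij]; last first.
  by apply: (determinant_alternate ij) => k; rewrite !mxE vij.
rewrite -[\det (gram (upd v i u') w)]mul1r; apply: (@determinant_multilinear _ _ _ _ _ i).
- apply/rowP => j; rewrite !mxE /upd eqxx.
  by rewrite gC (gl (w j) a u u') mul1r !(gC _ (w j)).
- by apply/matrixP => k j; rewrite !mxE /upd eq_sym (negbTE (neq_lift _ _)).
- by apply/matrixP => k j; rewrite !mxE /upd eq_sym (negbTE (neq_lift _ _)).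
Qed.

Lemma wedge_alternating (v : 'I_n -> V) alpha :
  Defs.alternating alpha -> wedge v alpha = alpha v.
Proof. by rewrite /= /wedge_fun; case: pselect. Qed.

(** The inner evaluation leaves a determinant with the variable in the second slot; symmetry of [g]
    and transposition move it to the first, where the form is alternating. *)
Lemma ext_norm_wedge v : ext_norm g (wedge v) = Num.sqrt (\det (gram v v)).
Proof.
have inner u : wedge v (fun v' => \det (gram v' u) : R^o) = \det (gram v u).
  exact: wedge_alternating (det_gram_alternating u).
rewrite /ext_norm; under eq_fun do rewrite inner gramC det_tr.
by rewrite (wedge_alternating v (det_gram_alternating v)).
Qed.

(** The quadratic form of the Gram matrix at [u] is [g s s] for the combination [s] of the [v i]
    with coefficients [u]. *)
Lemma det_gram_gt0 v :
  (forall a : 'I_n -> R, \sum_i a i *: v i = 0 -> forall i, a i = 0) ->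
  0 < \det (gram v v).
Proof.
move=> free; apply: det_posdef_gt0 => u u0.
pose g' x : {linear V -> R^o} := HB.pack (g x)
  (GRing.isLinear.Build R V R^o _ (g x) (gl x)).
have suml x (a : 'I_n -> R) : g x (\sum_i a i *: v i) = \sum_i a i * g x (v i).
  rewrite -[g x]/(g' x : V -> R^o) linear_sum.
  by apply: eq_bigr => i _; rewrite linearZ.
set s := \sum_i u 0 i *: v i.
have -> : (u *m gram v v *m u^T) 0 0 = g s s.
  rewrite [in RHS]/s suml mxE; apply: eq_bigr => j _.
  rewrite gC suml !mxE mulrC; congr (_ * _).
  by apply: eq_bigr => i _; rewrite !mxE gC.
apply: gpos; apply: contra u0 => /eqP/free u0.
by apply/eqP/rowP => i; rewrite u0 mxE.
Qed.

Lemma wedge_neq0 v : 0 < \det (gram v v) -> wedge v != 0.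
Proof.
move=> d0; have : ext_norm g (wedge v) != 0 by rewrite ext_norm_wedge sqrtr_eq0 -ltNge.
by apply: contra => /eqP ->; rewrite /ext_norm /= sqrtr0.
Qed.

Lemma unit_density_wedge t v : 0 < \det (gram v v) ->
  unit_density_at n t g (wedge v) = \det (gram v v) `^ (2^-1 * (- t / n%:R)).
Proof.
move=> d0; rewrite /= /unit_density_fun (negbTE (wedge_neq0 d0)) ext_norm_wedge.
by rewrite -(powR12_sqrt (ltW d0)) -powRrM.
Qed.

End WedgeNorm.

(** * Chain rule along lines and smoothness of real powers *)

Section ChainRule.
Context {R : realType} {V : normedModType R}.
Implicit Types (f : V -> R) (u v : V).

Lemma derive_line f u v : 'D_v f u = 'D_1 (fun h : R => f (h *: v + u)) 0.
Proof.
rewrite /derive; set d := (fun h : R => _ *: (_ (h *: v) - _)).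
set d' := (fun h : R => _ *: (_ (h *: 1) - _)).
suff -> : d = d' by [].
by apply/funext => h; rewrite /d /d' /= addr0 [h%:A]mulr1 scale0r add0r.
Qed.

(** Stated for one direction because [Ck] supplies only partial derivatives; restriction to a line
    reduces it to one variable. *)
Lemma is_derive_comp1 (phi : R -> R) f u v a :
  is_derive (f u) 1 phi a -> derivable f u v ->
  is_derive u v (fun w => phi (f w)) (a * 'D_v f u).
Proof.
move=> dphi /derivable1P/derivableP df.
have dphi0 : is_derive (f (0 *: v + u)) 1 phi a by rewrite scale0r add0r.
have [dphif E] := @is_derive1_comp _ phi (fun h : R => f (h *: v + u)) 0 a _ dphi0 df.
split; first exact: (proj2 (derivable1P (fun w => phi (f w)) u v) dphif).
by rewrite derive_line [LHS]E -derive_line.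
Qed.

End ChainRule.

Section SmoothPower.
Context {R : realType} {n : nat}.

(** The partial derivative of [f ^ a] involves [f ^ (a - 1)], hence the induction on [k] is for all
    exponents at once. *)
Lemma Ck_powR (U : set 'rV[R]_n) k (a : R) f : open U ->
  (forall u, U u -> 0 < f u) -> Ck U k f -> Ck U k (fun u => f u `^ a).
Proof.
move=> oU f0.
have dpow b u : U u -> is_derive (f u) 1 (@powR R ^~ b) (b * f u `^ (b - 1)).
  by move=> /f0; exact: is_derive1_powR.
elim: k a => [|k IH] a Cf; (split; first by move=> u Uu;
  apply: (@continuous_comp _ _ _ f (@powR R ^~ a)); [exact: Ck_cont Cf Uu|];
  apply: differentiable_continuous; apply/derivable1_diffP; case: (dpow a u Uu)) => //.
move=> i; have [_ /(_ i)[di Di]] := Cf.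
have dfa u : U u -> is_derive u (ebase i) (fun w => f w `^ a)
    (a * f u `^ (a - 1) * 'D_(ebase i) f u).
  by move=> Uu; apply: is_derive_comp1 (dpow a u Uu) (di u Uu).
split=> [u Uu|]; first by case: (dfa u Uu).
have := CkM oU (CkM oU (Ck_cst U k a) (IH (a - 1) (Ck_weak Cf))) Di.
by apply: Ck_eq => // u Uu; case: (dfa u Uu).
Qed.

Context {M : manifoldType R n}.

Lemma smooth_at_cont (f : M -> R) x : smooth_at f x -> {for x, continuous f}.
Proof.
move=> [V [oV Vx sf]]; have [phi aphi dx] := @atlas_cover _ _ M x.
have Vdx : nbhs x (chart_dom phi).
  exact: open_nbhs_nbhs (conj (chart_dom_open phi) dx).
apply: (@near_eq_cont _ _ ((f \o chart_bwd phi) \o chart_fwd phi)).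
  by apply: filterS Vdx => y dy /=; rewrite chart_fwdK.
apply: (@continuous_comp _ _ _ (chart_fwd phi) (f \o chart_bwd phi)).
  exact: chart_fwd_cont.
by apply: Ck_cont (sf phi aphi 0%N) _; exists x.
Qed.

Lemma smooth_at_powR (f : M -> R) x a :
  smooth_at f x -> 0 < f x -> smooth_at (fun y => f y `^ a) x.
Proof.
move=> sf fx0; have f_pos : \near x, 0 < f x.
  exact: (smooth_at_cont sf (lt_nbhsr fx0)).
have [V [oV Vx sfV]] := sf.
exists (V `&` interior [set y | 0 < f y]); split=> //.
  by apply: openI => //; exact: open_interior.
move=> phi aphi k; apply: Ck_powR.
- by apply: chart_image_open; apply: openI => //; exact: open_interior.
- move=> _ [y [[_ fy] dy] <-] /=; rewrite chart_fwdK //.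
  exact: (interior_subset fy).
- apply: Ck_sub (sfV phi aphi k) => _ [y [[Vy _] dy] <-].
  by exists y.
Qed.

Lemma smooth_at_sum (I : Type) (r : seq I) (F : I -> M -> R) x :
  (forall i, smooth_at (F i) x) -> smooth_at (fun y => \sum_(i <- r) F i y) x.
Proof.
move=> sF; elim: r => [|i r IH]; under eq_fun do rewrite ?big_nil ?big_cons.
  exact: smooth_at_cst.
exact: smooth_atD.
Qed.

Lemma smooth_at_prod (I : Type) (r : seq I) (F : I -> M -> R) x :
  (forall i, smooth_at (F i) x) -> smooth_at (fun y => \prod_(i <- r) F i y) x.
Proof.
move=> sF; elim: r => [|i r IH]; under eq_fun do rewrite ?big_nil ?big_cons.
  exact: smooth_at_cst.
exact: smooth_atM.
Qed.

Lemma smooth_at_det k (B : M -> 'M[R]_k) x :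
  (forall i j, smooth_at (fun y => B y i j) x) -> smooth_at (fun y => \det (B y)) x.
Proof.
move=> sB; apply: smooth_at_sum => s; apply: smooth_atM; first exact: smooth_at_cst.
exact: smooth_at_prod.
Qed.

End SmoothPower.

(** * Coordinate derivations of a chart *)

Section CoordinateFrame.
Context {R : realType} {n : nat} {M : manifoldType R n}.
Variables (phi : chart R n M) (aphi : atlas M phi) (x : M) (dx : chart_dom phi x).

Lemma smooth_at_derivable f (i : 'I_n) : smooth_at f x ->
  derivable (f \o chart_bwd phi) (chart_fwd phi x) (ebase i).
Proof.
move=> [V [oV Vx sf]]; have [_ /(_ i)[di _]] := sf phi aphi 1%N.
by apply: di; exists x.
Qed.

Definition coord_deriv (i : 'I_n) (f : M -> R) : R :=
  if pselect (smooth_at f x)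
  then 'D_(ebase i) (f \o chart_bwd phi) (chart_fwd phi x) else 0.

Lemma coord_derivE i f : smooth_at f x ->
  coord_deriv i f = 'D_(ebase i) (f \o chart_bwd phi) (chart_fwd phi x).
Proof. by rewrite /coord_deriv; case: pselect. Qed.

Lemma coord_derivation i : coord_deriv i \in derivation_pred x.
Proof.
apply/asboolP; split=> [f nf|f h sf fh|a f h sf sh|f h sf sh].
- by rewrite /coord_deriv; case: pselect.
- rewrite !coord_derivE //; last exact: smooth_at_eq sf.
  apply: near_eq_derive; apply: (@chart_bwd_cont _ _ _ phi x dx [set y | f y = h y]).
  by rewrite chart_fwdK.
- have df := smooth_at_derivable (i := i) sf; have dh := smooth_at_derivable (i := i) sh.
  rewrite !coord_derivE //; last exact: smooth_atZD.
  rewrite -[a * _]/(a *: _) -deriveZ // -deriveD //.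
  exact: derivableZ.
- have df := smooth_at_derivable (i := i) sf; have dh := smooth_at_derivable (i := i) sh.
  rewrite !coord_derivE //; last exact: smooth_atM.
  by have := deriveM df dh; rewrite /= chart_fwdK.
Qed.

Definition coord_vector (i : 'I_n) : tangent x := Tangent (coord_derivation i).

Lemma smooth_coord j : smooth_at (Defs.coord phi j) x.
Proof.
exists (chart_dom phi); split=> //; first exact: chart_dom_open.
move=> psi apsi; rewrite setIC; exact: atlas_smooth.
Qed.

Lemma coord_vector_coord i j : coord_vector i (Defs.coord phi j) = (i == j)%:R.
Proof.
rewrite /= coord_derivE; last exact: smooth_coord.
pose u := chart_fwd phi x.
(* The chart image is open, so near [u] the two chart maps are inverse in this order as well. *)
have E : \forall w \near u, (w : 'rV[R]_n) 0 j = (Defs.coord phi j \o chart_bwd phi) w.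
  have := open_nbhs_nbhs (conj (chart_img_open phi) (imageP (chart_fwd phi) dx)).
  by apply: filterS => _ [y dy <-]; rewrite /Defs.coord /= chart_fwdK.
rewrite -(near_eq_derive (ebase i) E) derive_line.
have -> : (fun h : R => (h *: ebase i + chart_fwd phi x) 0 j) =
    (fun h : R => (i == j)%:R *: h + chart_fwd phi x 0 j).
  by apply/funext => h; rewrite !mxE eqxx /= [j == i]eq_sym mulrC.
rewrite deriveD ?derive_cst ?addr0; [|by apply: derivableZ|by []].
by rewrite deriveZ // derive_id /GRing.scale /= mulr1.
Qed.

(** Applying the relation to the coordinate functions isolates each coefficient. *)
Lemma coord_vector_free (a : 'I_n -> R) :
  \sum_i a i *: coord_vector i = 0 -> forall i, a i = 0.
Proof.
move=> a0 j; have := congr1 (fun v : tangent x => v (Defs.coord phi j)) a0.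
have -> : (\sum_i a i *: coord_vector i : tangent x) (Defs.coord phi j) =
    \sum_i a i * coord_vector i (Defs.coord phi j).
  elim/big_rec2: _ => // i y v _ <-; exact: tangent_lin.
rewrite (bigD1 j) // coord_vector_coord eqxx mulr1 big1 => [|i ij].
  by rewrite [X in X = _ -> _]addr0.
by rewrite coord_vector_coord (negbTE ij) mulr0.
Qed.

End CoordinateFrame.

Lemma tangent_frame (R : realType) n (M : manifoldType R n) (x : M) :
  exists v : 'I_n -> tangent x,
    forall a : 'I_n -> R, \sum_i a i *: v i = 0 -> forall i, a i = 0.
Proof.
have [phi aphi dx] := @atlas_cover _ _ M x.
exists (coord_vector aphi dx); exact: coord_vector_free.
Qed.

(** * The unit density as a smooth section without zeros *)

Section UnitDensity.
Context {R : realType} {n : nat} {M : manifoldType R n} (g : metric M).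

Lemma unit_density_neq0 t x : unit_density g t x != 0.
Proof.
have [v /(det_gram_gt0 (@Defs.metric_linear _ _ _ g x) (@Defs.metric_sym _ _ _ g x)
  (@Defs.metric_pos _ _ _ g x)) d0] := tangent_frame x.
have : unit_density g t x (wedge v) != 0.
  rewrite (unit_density_wedge (@Defs.metric_linear _ _ _ g x) (@Defs.metric_sym _ _ _ g x)) //.
  by rewrite gt_eqF // powR_gt0.
by apply: contra => /eqP ->.
Qed.

Lemma unit_density_smooth t : unit_density g t \in @smooth_section_pred R n M t.
Proof.
apply/asboolP => X x /(det_gram_gt0 (@Defs.metric_linear _ _ _ g x) (@Defs.metric_sym _ _ _ g x)
  (@Defs.metric_pos _ _ _ g x)) d0.
pose d y := \det (gram (@g y) (fun i => X i y) (fun i => X i y)).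
have sd : smooth_at d x.
  apply: smooth_at_det => i j.
  under eq_fun do rewrite mxE; exact: Defs.metric_smooth.
apply: (@smooth_at_eq _ _ _ (fun y => d y `^ (2^-1 * (- t / n%:R)))).
  (* The power formula needs a positive Gram determinant, which continuity provides around [x]. *)
  have d_pos : \forall y \near x, 0 < d y := smooth_at_cont sd (lt_nbhsr d0).
  apply: filterS d_pos => y dy.
  by rewrite -(unit_density_wedge (@Defs.metric_linear _ _ _ g y) (@Defs.metric_sym _ _ _ g y)).
exact: smooth_at_powR.
Qed.

Definition unit_section t : Gam M t := GamSection (unit_density_smooth t).

(** The hypotheses make the total exponent nonzero, so that powers add even for a base 0, where
    exponent 0 would give 1. *)
Lemma unit_density_mul s t x : (0 < n)%N -> s + t != 0 ->
  density_mul (unit_density g s x) (unit_density g t x) = unit_density g (s + t) x.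
Proof.
move=> n0 st; apply/val_inj/funext => w /=; rewrite /unit_density_fun.
case: (w == 0); first by rewrite mul0r.
rewrite opprD mulrDl powRD // -mulrDl -opprD mulf_eq0 oppr_eq0 (negbTE st).
by rewrite invr_eq0 pnatr_eq0 eqn0Ngt n0.
Qed.

End UnitDensity.

(** * Comparison of the two structures at a point *)

Section Pointwise.
Context {R : realType} {m : nat} {M : manifoldType R (m + m)}.
Variables (c : tensor2 M) (J : endo M) (g : metric M).
Hypothesis hg : in_class c g.

Lemma fundamental_formE x (v w : tangent x) :
  fundamental_form c J v w = kahler_form J g v w *: unit_density g 2 x.
Proof. exact: hg. Qed.

Lemma scale_unit_inj x : injective (fun a : R^o => a *: unit_density g 2 x).
Proof.
move=> a b /eqP; rewrite -subr_eq0 -scalerBl scaler_eq0.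
by rewrite (negbTE (unit_density_neq0 g 2 x)) orbF subr_eq0 => /eqP.
Qed.

(** Both musical maps choose by [xget] with the same default, so equal solution sets give equal
    vectors. *)
Lemma sharpE x (alpha : tangent x -> Lbun 2 x) (beta : tangent x -> R^o) :
  (forall w, alpha w = beta w *: unit_density g 2 x) ->
  sharp c J alpha = sharp_g J g beta.
Proof.
move=> ab; rewrite /sharp /sharp_g; congr (xget 0 _).
apply/seteqP; split=> v /= vE w.
  by apply: (@scale_unit_inj x); rewrite -fundamental_formE vE ab.
by rewrite fundamental_formE ab vE.
Qed.

Variables (omega : form1 M) (D1 : connection M 1) (D2 : connection M 2).
Hypotheses (hD1 : canonical_Weyl c J D1) (hD2 : induced_connection2 D1 D2).
Hypotheses (homega : lee_form J g omega) (m0 : (0 < m)%N).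

Lemma nabla_scaled_unit (s : Gam M 2) (f : cinf M) x (v : tangent x) :
  (forall y, s y = f y *: unit_density g 2 y) ->
  D2 s x v = twisted_d omega f v *: unit_density g 2 x.
Proof.
move=> sE; pose l := unit_section g 1.
have lE y : l y = unit_density g 1 y by [].
have l2 y : sec_mul l l y = unit_density g 2 y :> Lbun 2 y.
  by apply: unit_density_mul; rewrite ?addn_gt0 ?m0 // pnatr_eq0.
(* The induced connection is prescribed only on products of sections of weight 1; [2] unfolds to
   [1 + 1], which makes [sec_mul l l] a section of weight 2. *)
have -> : s = fsec f (sec_mul l l : Gam M 2).
  apply/val_inj/functional_extensionality_dep => y.
  by rewrite -[LHS]/(s y) sE -l2.
rewrite nabla_leibniz hD2 (hD1 hg homega lE).
have mulZ (a : R) (u w : Lbun 1 x) :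
    density_mul (a *: u : Lbun 1 x) w = a *: density_mul u w /\
    density_mul u (a *: w : Lbun 1 x) = a *: density_mul u w.
  by split; apply/val_inj/funext => z; [exact/esym/mulrA|exact: mulrCA].
rewrite (mulZ _ _ _).1 (mulZ _ _ _).2 -[density_mul _ _]/(sec_mul l l x) l2.
(* Each factor [l] contributes one half of [omega]. *)
rewrite -scalerDl scalerA -scalerDl /twisted_d; congr (_ *: _).
by field.
Qed.

End Pointwise.

Theorem theorem5p10 (R : realType) (m : nat) (M : manifoldType R (m + m))
    (c : tensor2 M) (J : endo M) (hM : lcK c J)
    (p : nat) (G : lieGroupType R p) (A : lie_action G M)
    (hG : connected_subgroup_of_Aut c J A)
    (D1 : connection M 1) (D2 : connection M 2)
    (hD1 : canonical_Weyl c J D1) (hD2 : induced_connection2 D1 D2)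
    (g : metric M) (hg : in_class c g)
    (omega_g : form1 M) (homega : lee_form J g omega_g)
    (mu : lie_algebra G -> Gam M 2) (mu_g : lie_algebra G -> cinf M)
    (hmu : forall X x, mu X x = mu_g X x *: unit_density g 2 x) :
  conformal_momentum_map A c J D2 mu <->
  metric_momentum_map A J g omega_g mu_g.
Proof.
(* Density exponents are divided by the real dimension, which must be nonzero. *)
have m0 : (0 < m)%N by case: hM => m1 _ _ _; exact: ltnW.
have nablaE X x (v : tangent x) :
    D2 (mu X) x v = twisted_d omega_g (mu_g X) v *: unit_density g 2 x.
  exact: (nabla_scaled_unit hg hD1 hD2 homega m0 v (hmu X)).
have poissonE X Y x : poisson c J D2 (mu X) (mu Y) x =
    poisson_g J g omega_g (mu_g X) (mu_g Y) x *: unit_density g 2 x.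
  by rewrite /poisson !(sharpE J hg (nablaE _ x)) (fundamental_formE _ hg).
have inj x := @scale_unit_inj _ _ _ g x.
(* Towards functions, each clause is multiplied by the unit density, translated, and cancelled by
   [inj]; towards sections, direct substitution suffices. *)
split=> -[lin brk mom]; split.
- move=> a X Y; apply/val_inj/funext => x; apply: (inj x).
  rewrite /= -hmu lin -[LHS]/(a *: mu X x + mu Y x) !hmu scalerA -scalerDl.
  by [].
- by move=> X Y x; apply: (inj x); rewrite /= -hmu brk poissonE.
- by move=> X x v; apply: (inj x); rewrite /= -(fundamental_formE _ hg) mom nablaE.
- move=> a X Y; apply/val_inj/functional_extensionality_dep => x.
  rewrite -[LHS]/(mu _ x) -[RHS]/(a *: mu X x + mu Y x) !hmu lin.
  by rewrite scalerA -scalerDl.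
- by move=> X Y x; rewrite hmu brk poissonE.
- by move=> X x v; rewrite (fundamental_formE _ hg) mom nablaE.
Qed.
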